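(* Let $m,k$ be positive integers with $\gcd(k,m)=1$, let $K=\mathbb{F}_{2^m}$ and let $\sigma\colon K\to K$, $x\mapsto x^{2^k}$. Let $\alpha_1,\alpha_2\in K$ be such that neither $X^{\sigma+1}+X+\alpha_1$ nor $X^{\sigma+1}+X+\alpha_2$ has a root in $K$. Then $F_{\alpha_1,\sigma}$ and $F_{\alpha_2,\sigma}$ are linear equivalent. In particular, if $3\nmid m$, then for every $\alpha\in K$ such that $X^{\sigma+1}+X+\alpha$ has no root in $K$, the function $F_{\alpha,\sigma}$ is linear equivalent to a function of the form $$(x,y)\mapsto (x^{\tau+1}+xy^{\tau}+y^{\tau+1},\;x^{\tau^2+1}+x^{\tau^2}y+y^{\tau^2+1})$$ on $K^2$, where $\tau\colon x\mapsto x^{2^l}$ is a field automorphism of $K$ with $\gcd(3l,m)=1$.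
   Context: For $K=\mathbb{F}_{2^m}$, a field automorphism $\sigma\colon x\mapsto x^{2^k}$ of $K$ with $\gcd(k,m)=1$, and $\alpha\in K$, define $F_{\alpha,\sigma}\colon K^2\to K^2$ by $F_{\alpha,\sigma}=(f_{\alpha,\sigma},g_{\alpha,\sigma})$ with $$f_{\alpha,\sigma}(x,y)=x^{\sigma+1}+xy^\sigma+\alpha y^{\sigma+1},$$ $$g_{\alpha,\sigma}(x,y)=x^{\sigma^2+1}+\alpha x^{\sigma^2}y+(1+\alpha^\sigma)xy^{\sigma^2}+\alpha y^{\sigma^2+1}.$$ Exponent notation: $x^\sigma=\sigma(x)=x^{2^k}$, $x^{\sigma+1}=\sigma(x)\,x$, $x^{\sigma^2}=\sigma(\sigma(x))$, $x^{\sigma^2+1}=\sigma(\sigma(x))\,x$; similarly for $\tau$. It is known that $F_{\alpha,\sigma}$ is APN whenever $X^{\sigma+1}+X+\alpha$ has no root in $K$ (a function $F$ on an $\mathbb{F}_2$-vector space $V$ is APN if for all $a\neq 0$ and all $b$ the equation $F(x+a)+F(x)=b$ has at most $2$ solutions $x \in V$). Two functions $F,G\colon K^2\to K^2$ are linear equivalent if there are $\mathbb{F}_2$-linear bijections $L,M$ of $K^2$ with $L\circ F=G\circ M$. *)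

(* Defs.v *)
From HB Require Import structures.
From mathcomp Require Import all_boot all_order all_algebra all_field.
Set Implicit Arguments.
Unset Strict Implicit.
Unset Printing Implicit Defensive.
Import GRing.Theory.
Local Open Scope ring_scope.

Definition frob (K : fieldExtType 'F_2) (k : nat) (x : K) : K := x ^+ (2 ^ k).

(* In the maps below an exponent s^i + 1 denotes iter i s x * x, not a power
   with a natural number exponent. *)
Definition famF (K : fieldExtType 'F_2) (s : K -> K) (a : K) (p : K * K) :
    K * K :=
  let: (x, y) := p in
  (s x * x + x * s y + a * (s y * y),
   s (s x) * x + a * s (s x) * y + (1 + s a) * x * s (s y)
     + a * (s (s y) * y)).

Definition famG (K : fieldExtType 'F_2) (t : K -> K) (p : K * K) : K * K :=
  let: (x, y) := p in
  (t x * x + x * t y + t y * y,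
   t (t x) * x + t (t x) * y + t (t y) * y).

(* The polynomial X^(s+1) + X + a for s = frob k. *)
Definition projpoly (K : fieldExtType 'F_2) (k : nat) (a : K) : {poly K} :=
  'X^(2 ^ k + 1) + 'X + a%:P.

Definition has_no_root (K : fieldExtType 'F_2) (q : {poly K}) : Prop :=
  forall x : K, ~~ root q x.

Definition linear_equivalent (K : fieldExtType 'F_2) (F G : K * K -> K * K) :
    Prop :=
  exists L M : {linear (K * K)%type -> (K * K)%type},
    [/\ bijective L, bijective M & forall p, L (F p) = G (M p)].

(* Main.v *)
Require Import Defs.
From HB Require Import structures.
From mathcomp Require Import all_boot all_order all_algebra all_field.
From mathcomp Require Import ring.
Set Implicit Arguments.
Unset Strict Implicit.
Unset Printing Implicit Defensive.
Import GRing.Theory.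
Local Open Scope ring_scope.

(** Write [s] for the Frobenius power [frob k]. Put [A_a] for the matrix with
rows [(0, a)] and [(1, 1)], and let [T_a v = A_a s(v)] act semilinearly on the
column vectors over [K]. If [<v, w>] is the determinant form on the plane, then
[F_a v = (<v, T_a v>, <v, T_a (T_a v)>)] ([famF_wedge]). Hence an invertible
matrix [P] with [P T_a1 = T_a2 P] carries one map to the other: the values at
[P v] are [\det P] times the values at [v]. It remains to see that all the
operators [T_a] are conjugate when the polynomials have no root.

Absence of roots says that [<v, T_a v>] vanishes only at [v = 0], that is, that
[T_a] has no invariant line. As [s] generates the Galois group of [K] over the
field with two elements, Lang's theorem identifies the conjugacy classes of
invertible semilinear operators with those of [GL_2(F_2)], a group isomorphic to
[S_3], through the linear map [T ^ m]. The operators without an invariant line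
belong to the single class of elements of order 3. The proof makes this explicit.

- The matrix [N] of [T ^ m] is conjugate to [s(N)], so its determinant and its
  trace are in [F_2]. Its determinant is 1. If its trace were 0, [T ^ m] would
  fix a nonzero vector, thus so would [T] by the additive Hilbert 90 argument
  ([semilinear_fixed_point]), against the absence of invariant lines. So
  [N ^ 2 = N + 1] ([anisotropic_mxnorm]).
- Since the matrices [N1] and [N2] of two such operators satisfy the same
  quadratic equation, some nonzero [Q] has [N2 Q = Q N1]
  ([anisotropic_intertwiner]). It is a fixed vector of the [m]-th power of the
  semilinear operator [X |-> A2 s(X) A1^-1] on the matrices. By Hilbert 90 again
  that operator fixes some [P != 0] ([anisotropic_twisted_conjugate]). The
  kernel of [P] is invariant under the first operator, so [P] is invertible.

For the second claim, the target maps are the members [F_1] of the family. If 3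
does not divide [m], then [s] can be kept and [F_1] belongs to the same class:
a root of [X^(s+1) + X + 1] is a fixed point of the composite of [s] and a
Moebius transformation of order 3 with coefficients in [F_2], so it is fixed by
[s ^ 3], which generates the Galois group; but neither 0 nor 1 is a root
([no_root_projpoly1]). *)

(** * The determinant form on the plane *)

Section Plane.

Variable F : fieldType.
Implicit Types (P : 'M[F]_2) (v w : 'cV[F]_2).

Definition wedge v w : F := v 0 0 * w 1 0 - v 1 0 * w 0 0.

Lemma mulmx2E q P (X : 'M[F]_(2, q)) i j :
  (P *m X) i j = P i 0 * X 0 j + P i 1 * X 1 j.
Proof.
rewrite mxE big_ord_recl big_ord1.
by congr (_ + P _ _ * X _ _); apply: val_inj.
Qed.

Lemma det2E P : \det P = P 0 0 * P 1 1 - P 0 1 * P 1 0.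
Proof.
have e10 : lift 0 0 = 1 :> 'I_2 by apply: val_inj.
rewrite (expand_det_row _ 0) big_ord_recl big_ord1 /cofactor !det_mx11 !mxE /=.
rewrite !e10; have -> : lift 1 0 = 0 :> 'I_2 by apply: val_inj.
rewrite /bump /=; ring.
Qed.

Lemma tr2E P : \tr P = P 0 0 + P 1 1.
Proof.
by rewrite /mxtrace big_ord_recl big_ord1; congr (_ + P _ _); apply: val_inj.
Qed.

Lemma ord2P (Q : 'I_2 -> Prop) : Q 0 -> Q 1 -> forall i, Q i.
Proof.
by move=> Q0 Q1 [[|[|//]] lti]; [move: Q0|move: Q1]; congr Q; apply: val_inj.
Qed.

Lemma wedge_mulmx P v w : wedge (P *m v) (P *m w) = \det P * wedge v w.
Proof. by rewrite /wedge !mulmx2E det2E; ring. Qed.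

Lemma wedgevv v : wedge v v = 0.
Proof. by rewrite /wedge; ring. Qed.

(** The kernel of a nonzero matrix is at most a line, on which the form
vanishes. *)
Lemma wedge_ker P v w : P != 0 -> P *m v = 0 -> P *m w = 0 -> wedge v w = 0.
Proof.
move=> nzP Pv0 Pw0; apply/eqP; apply: contraNT nzP => nzvw.
have Pv i : P i 0 * v 0 0 + P i 1 * v 1 0 = 0 by rewrite -mulmx2E Pv0 mxE.
have Pw i : P i 0 * w 0 0 + P i 1 * w 1 0 = 0 by rewrite -mulmx2E Pw0 mxE.
have P0 i : P i 0 = 0.
  apply: (mulIf nzvw); rewrite mul0r /wedge.
  transitivity (w 1 0 * (P i 0 * v 0 0 + P i 1 * v 1 0)
                - v 1 0 * (P i 0 * w 0 0 + P i 1 * w 1 0)); first by ring.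
  by rewrite Pv Pw; ring.
have P1 i : P i 1 = 0.
  apply: (mulIf nzvw); rewrite mul0r /wedge.
  transitivity (v 0 0 * (P i 0 * w 0 0 + P i 1 * w 1 0)
                - w 0 0 * (P i 0 * v 0 0 + P i 1 * v 1 0)); first by ring.
  by rewrite Pv Pw; ring.
by apply/eqP/matrixP=> i j; rewrite mxE; move: j; apply: ord2P.
Qed.

Lemma det0_ker P : \det P = 0 -> exists2 v : 'cV_2, v != 0 & P *m v = 0.
Proof.
rewrite -det_tr => /eqP/det0P[u nzu uP0]; exists u^T; first by rewrite trmx_eq0.
by apply: trmx_inj; rewrite trmx_mul trmxK uP0 trmx0.
Qed.

Lemma cayley_hamilton2 P : P *m P = \tr P *: P - (\det P)%:M.
Proof.
apply/matrixP=> i j; move: i j; apply: ord2P; apply: ord2P;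
  by rewrite mulmx2E !mxE tr2E det2E /=; ring.
Qed.

Lemma det_addr1 P : \det (P + 1%:M) = \det P + \tr P + 1.
Proof. by rewrite !det2E tr2E !mxE /=; ring. Qed.

End Plane.

(** * Semilinear operators given by a matrix *)

Section Twist.

Variables (F : fieldType) (s : {rmorphism F -> F}).

Definition twist q (A : 'M[F]_2) (X : 'M[F]_(2, q)) := A *m map_mx s X.

(** The matrix [A s(A) ... s^(j-1)(A)] of the [j]-th power of the operator, up
to the action of [s ^ j] on the coordinates. *)
Definition mxnorm (A : 'M[F]_2) j : 'M[F]_2 := iter j (twist A) 1%:M.

(** Since [wedge v w = 0] means that [v] and [w] are dependent, this says that
the operator has no invariant line and no kernel. *)
Definition anisotropic (A : 'M[F]_2) :=
  forall v : 'cV[F]_2, wedge v (twist A v) = 0 -> v = 0.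

Lemma iter_twist q A (X : 'M[F]_(2, q)) j :
  iter j (twist A) X = mxnorm A j *m iter j (map_mx s) X.
Proof.
elim: j => [|j IHj]; first by rewrite mul1mx.
by rewrite /= IHj {1}/twist map_mxM mulmxA.
Qed.

Lemma mxnormSr A j : mxnorm A j.+1 = mxnorm A j *m iter j (map_mx s) A.
Proof. by rewrite /mxnorm iterSr iter_twist /twist map_mx1 mulmx1. Qed.

Lemma iter_map_mx_id p q (X : 'M[F]_(p, q)) j :
  (forall x, iter j s x = x) -> iter j (map_mx s) X = X.
Proof.
move=> sj; apply/matrixP=> a b; rewrite -[RHS]sj.
by elim: j {sj} => //= j <-; rewrite mxE.
Qed.

End Twist.

(** * Conjugacy of semilinear operators without an invariant line *)

Section Frobenius.

Variable K : fieldExtType 'F_2.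

Lemma pchar2 : 2 \in [pchar K].
Proof. by rewrite pchar_lalg pchar_Fp. Qed.

Variable k : nat.

Lemma frob_zmod_morphism : zmod_morphism (@frob K k).
Proof.
move=> x y; rewrite /frob exprDn_pchar ?exprNn_pchar //;
  by rewrite (eq_pnat _ (pcharf_eq pchar2)) pnatX pnat_id.
Qed.

Lemma frob_monoid_morphism : monoid_morphism (@frob K k).
Proof. by split=> [|x y]; rewrite /frob ?expr1n ?exprMn. Qed.

HB.instance Definition _ := GRing.isZmodMorphism.Build K K
  (@frob K k) frob_zmod_morphism.
HB.instance Definition _ := GRing.isMonoidMorphism.Build K K
  (@frob K k) frob_monoid_morphism.

Lemma iter_frob j x : iter j (@frob K k) x = x ^+ (2 ^ (k * j)).
Proof.
elim: j => [|j IHj]; first by rewrite muln0.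
by rewrite /= IHj /frob -exprM -expnD mulnS addnC.
Qed.

Variables (m : nat) (m_gt0 : (0 < m)%N) (co_km : coprime k m).
Variable dimK : \dim {:K} = m.

Lemma card_binary_ext : #|finvect_type K| = (2 ^ m)%N.
Proof.
have := card_vspace {: finvect_type K}.
by rewrite card_vspacef card_Fp // dimK.
Qed.

Lemma expr_card_binary_ext (x : K) j : x ^+ (2 ^ (m * j)) = x.
Proof.
elim: j => [|j IHj]; first by rewrite muln0.
rewrite mulnS expnD mulnC exprM IHj -card_binary_ext.
exact: (expf_card (x : finvect_type K)).
Qed.

Lemma iter_frob_id (x : K) : iter m (@frob K k) x = x.
Proof. by rewrite iter_frob mulnC expr_card_binary_ext. Qed.

(** By Bezout and [x ^ (2 ^ m) = x], squaring is a power of [frob k] on [K], so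
a fixed point of [frob k] satisfies [x ^ 2 = x]. *)
Lemma frob_fixed (k_gt0 : (0 < k)%N) (x : K) :
  frob k x = x -> (x == 0) || (x == 1).
Proof.
move=> fx; have fix_iter j : x ^+ (2 ^ (k * j)) = x.
  by rewrite -iter_frob; elim: j => //= j ->.
have [a _ /dvdnP[b eb]] := Bezoutl m k_gt0.
have: x ^+ 2 = x.
  have := fix_iter b; rewrite [(k * b)%N]mulnC -eb (eqP co_km) expnD.
  by rewrite [(2 ^ 1 * _)%N]mulnC exprM [(a * m)%N]mulnC expr_card_binary_ext.
by move/eqP; rewrite -subr_eq0 expr2 -{3}[x]mulr1 -mulrBr mulf_eq0 subr_eq0.
Qed.

(** A case of the independence of the powers of an automorphism. Reducing the
exponents modulo [m] turns the sum into the value at [c] of a polynomial of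
degree less than the number of elements of [K]; the coefficient of ['X] in it
is [a 0], because only [j = 0] has [k * j] divisible by [m]. *)
Lemma frob_trace_neq0 (a : nat -> K) :
  a 0 != 0 -> exists c, \sum_(j < m) a j * iter j (frob k) c != 0.
Proof.
move=> nza; pose p := \sum_(j < m) a j *: 'X^(2 ^ (k * j %% m)).
have pE c : p.[c] = \sum_(j < m) a j * iter j (frob k) c.
  rewrite horner_sum; apply: eq_bigr => j _; rewrite !hornerE iter_frob.
  rewrite {2}(divn_eq (k * j) m) expnD exprM [(_ * m)%N]mulnC.
  by rewrite expr_card_binary_ext.
case: (boolP [exists c : finvect_type K, p.[c] != 0]) => [/existsP[c]|].
  by rewrite pE; exists c.
move/existsPn => p0; have nzp : p != 0.
  apply: contraNneq nza => p_0; have /esym := congr1 (coefp 1) p_0.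
  rewrite /= coef0 coef_sum (bigD1 (Ordinal m_gt0)) //= muln0 mod0n.
  rewrite coefZ coefXn mulr1 big1 ?addr0 => [-> //|j nzj]; rewrite coefZ coefXn.
  suff /negPf-> : 1%N != (2 ^ (k * j %% m))%N by rewrite mulr0.
  rewrite -[1%N]/(2 ^ 0)%N eqn_exp2l // eq_sym.
  rewrite -/(dvdn m (k * j)) Gauss_dvdr; last by rewrite coprime_sym.
  by rewrite gtnNdvd ?ltn_ord // lt0n.
have: (2 ^ m < size p)%N.
  rewrite -card_binary_ext cardE; apply: (@max_poly_roots K) => //.
    by apply/allP=> c _; have := p0 c; rewrite negbK rootE.
  exact: enum_uniq.
rewrite ltnNge => /negP[].
apply: leq_trans (size_sum _ _ _) _; apply/bigmax_leqP => j _.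
apply: leq_trans (size_scale_leq _ _) _; rewrite size_polyXn.
by rewrite ltn_exp2l // ltn_mod.
Qed.

(** Hilbert 90: if the [m]-th power of [Phi] fixes [X], then the trace
[\sum_n Phi^n (c X)] is fixed by [Phi] for all [c], and it is nonzero for some
[c] by independence of the powers of the Frobenius map. *)
Lemma semilinear_fixed_point p q (Phi : 'M[K]_(p, q) -> 'M[K]_(p, q)) X :
  {morph Phi : U V / U + V} -> (forall c U, Phi (c *: U) = frob k c *: Phi U) ->
  iter m Phi X = X -> X != 0 -> exists2 Y, Y != 0 & Phi Y = Y.
Proof.
move=> PhiD PhiZ PhiX /matrix0Pn[i [j nzX]].
have iterZ c n : iter n Phi (c *: X) = iter n (frob k) c *: iter n Phi X.
  by elim: n => //= n ->; rewrite PhiZ.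
have [c nzc] := @frob_trace_neq0 (fun n => iter n Phi X i j) nzX.
exists (\sum_(n < m) iter n Phi (c *: X)).
  apply: contraNneq nzc => /matrixP/(_ i j); rewrite mxE summxE => S0.
  by apply/eqP; rewrite -[RHS]S0; apply: eq_bigr => n _; rewrite iterZ mxE mulrC.
have Phi0 : Phi 0 = 0 by have := PhiZ 0 0; rewrite rmorph0 !scale0r.
rewrite (big_morph _ PhiD Phi0).
have: iter m Phi (c *: X) = c *: X by rewrite iterZ PhiX iter_frob_id.
case: m => [|n] En; first by rewrite !big_ord0.
by rewrite big_ord_recr big_ord_recl -[Phi _]/(iter n.+1 Phi _) En addrC.
Qed.

(** A kernel vector of [A] is the image under [frob k] of some [u], and then the
operator kills [u]. *)
Lemma anisotropic_unitmx A : anisotropic (@frob K k) A -> A \in unitmx.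
Proof.
move=> anA; rewrite unitmxE unitfE; apply/eqP=> /det0_ker[v nzv Av0].
have iter_m : iter m (map_mx (frob k)) v = v.
  by apply: iter_map_mx_id; apply: iter_frob_id.
case: m m_gt0 iter_m => // n _ /= fv.
set u := iter n _ v in fv; have u0 : u = 0.
  apply: anA; rewrite /twist fv Av0.
  by rewrite /wedge !mxE; ring.
by case/eqP: nzv; rewrite -fv u0 map_mx0.
Qed.

(** The relation [A s(N) = N A] puts the characteristic polynomial of [N] over
[F_2]; the cases with eigenvalue 0 or 1 are excluded, and
[X^2 + X + 1] remains. *)
Lemma anisotropic_mxnorm (k_gt0 : (0 < k)%N) A : anisotropic (@frob K k) A ->
  let N := mxnorm (frob k) A m in \tr N = 1 /\ N *m N = N + 1%:M.
Proof.
move=> anA N; have uA := anisotropic_unitmx anA.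
have sNE : A *m map_mx (frob k) N = N *m A.
  rewrite -[LHS]/(mxnorm (frob k) A m.+1) mxnormSr iter_map_mx_id //.
  exact: iter_frob_id.
have {}sNE : map_mx (frob k) N = invmx A *m (N *m A) by rewrite -sNE mulKmx.
have nz_det (B : 'M[K]_2) : B \in unitmx -> \det B != 0 by rewrite unitmxE unitfE.
have nzN : \det N != 0.
  rewrite /N /mxnorm; elim: (m) => [|n IHn] /=; first by rewrite det1 oner_neq0.
  by rewrite det_mulmx det_map_mx mulf_neq0 ?fmorph_eq0 // nz_det.
have detN : \det N = 1.
  have /(frob_fixed k_gt0) : frob k (\det N) = \det N.
    rewrite -det_map_mx sNE !det_mulmx mulrCA -det_mulmx mulVmx //.
    by rewrite det1 mulr1.
  by rewrite (negPf nzN) => /eqP.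
have trN : \tr N = 1.
  have /(frob_fixed k_gt0)/orP[/eqP tr0|/eqP//] : frob k (\tr N) = \tr N.
    by rewrite -trace_map_mx sNE mxtrace_mulC -mulmxA mulmxV // mulmx1.
  (* In characteristic 2, with [\det N = 1] and trace 0, 1 is an eigenvalue. *)
  have /det0_ker[v nzv] : \det (N + 1%:M) = 0.
    by rewrite det_addr1 tr0 detN addr0 addrr_pchar2 ?pchar2.
  rewrite mulmxDl mul1mx => /eqP; rewrite addr_eq0 => /eqP Nv.
  have {}Nv : N *m v = v.
    by rewrite Nv; apply/matrixP=> i j; rewrite mxE oppr_pchar2 ?pchar2.
  have Tv : iter m (twist (frob k) A) v = v.
    by rewrite iter_twist iter_map_mx_id //; apply: iter_frob_id.
  have [||w nzw Tw] := semilinear_fixed_point _ _ Tv nzv.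
  - by move=> U V; rewrite /twist map_mxD mulmxDr.
  - by move=> c U; rewrite /twist map_mxZ scalemxAr.
  by case/eqP: nzw; apply: anA; rewrite Tw wedgevv.
split=> //; rewrite cayley_hamilton2 trN detN scale1r; congr (_ + _).
by apply/matrixP=> i j; rewrite !mxE oppr_pchar2 ?pchar2.
Qed.

(** For every [X] the matrix [N2 X + X N1 + X] intertwines [N1] and [N2], as
both satisfy [N ^ 2 = N + 1]. If it vanished on the first row of elementary
matrices, the diagonal entries of [N1] would be equal, against [\tr N1 = 1]. *)
Lemma anisotropic_intertwiner (k_gt0 : (0 < k)%N) A1 A2 :
  anisotropic (@frob K k) A1 -> anisotropic (@frob K k) A2 ->
  exists2 Q, Q != 0 &
    mxnorm (frob k) A2 m *m Q = Q *m mxnorm (frob k) A1 m.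
Proof.
move=> anA1 anA2.
have [tr1 N1N1] := anisotropic_mxnorm k_gt0 anA1.
have [_ N2N2] := anisotropic_mxnorm k_gt0 anA2.
set N1 := mxnorm _ A1 m in tr1 N1N1 *; set N2 := mxnorm _ A2 m in N2N2 *.
pose Q X := N2 *m X + X *m N1 + X.
have QE X : N2 *m Q X = Q X *m N1.
  rewrite /Q !mulmxDr !mulmxDl !mulmxA N2N2 -[X *m N1 *m N1]mulmxA N1N1.
  rewrite !mulmxDl !mulmxDr mul1mx mulmx1.
  have char2 : 2%:R = 0 :> K by apply: pcharf0 pchar2.
  move: (N2 *m X) (X *m N1) (N2 *m X *m N1) => U V W.
  by apply/matrixP=> i j; rewrite !mxE; ring: char2.
case: (eqVneq (Q (delta_mx 0 0)) 0) => [Q0|]; last by exists (Q (delta_mx 0 0)).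
case: (eqVneq (Q (delta_mx 0 1)) 0) => [Q1|]; last by exists (Q (delta_mx 0 1)).
have e0 : N2 0 0 + N1 0 0 + 1 = 0.
  move/matrixP/(_ 0 0): Q0; rewrite mxE [in X in X + _]mxE !mulmx2E.
  by rewrite !mxE /= => <-; ring.
have e1 : N2 0 0 + N1 1 1 + 1 = 0.
  move/matrixP/(_ 0 1): Q1; rewrite mxE [in X in X + _]mxE !mulmx2E.
  by rewrite !mxE /= => <-; ring.
have /eqP := congr2 +%R e0 e1.
rewrite addr0 (_ : _ + _ = (N2 0 0 + 1) + (N2 0 0 + 1) + \tr N1).
  by rewrite addrr_pchar2 ?pchar2 // add0r tr1 oner_eq0.
by rewrite tr2E; ring.
Qed.

(** The equation says that [P] is fixed by [Phi : X |-> A2 s(X) A1^-1], and an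
intertwiner of the norms is a fixed vector of [Phi ^ m]. A kernel vector [v] of
[P] would give another one, the image of [v] under the first operator, and so
an invariant line. *)
Lemma anisotropic_twisted_conjugate (k_gt0 : (0 < k)%N) A1 A2 :
  anisotropic (@frob K k) A1 -> anisotropic (@frob K k) A2 ->
  exists2 P, P \in unitmx & P *m A1 = A2 *m map_mx (frob k) P.
Proof.
move=> anA1 anA2; have uA1 := anisotropic_unitmx anA1.
have [Q nzQ QE] := anisotropic_intertwiner k_gt0 anA1 anA2.
pose Phi (X : 'M[K]_2) := A2 *m map_mx (frob k) X *m invmx A1.
have uN1 n : mxnorm (frob k) A1 n \in unitmx.
  rewrite /mxnorm; elim: n => [|n IHn] /=; first exact: unitmx1.
  by rewrite unitmx_mul uA1 map_unitmx.
have iterPhi n : iter n Phi Q *m mxnorm (frob k) A1 n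
    = mxnorm (frob k) A2 n *m iter n (map_mx (frob k)) Q.
  rewrite -iter_twist; elim: n => [|n IHn]; first by rewrite mulmx1.
  by rewrite /= -IHn /twist map_mxM {1}/Phi -!mulmxA mulKmx.
have PhiQ : iter m Phi Q = Q.
  apply: (can_inj (mulmxK (uN1 m))); rewrite iterPhi iter_map_mx_id ?QE //.
  exact: iter_frob_id.
have [||P nzP PhiP] := semilinear_fixed_point _ _ PhiQ nzQ.
- by move=> U V; rewrite /Phi map_mxD mulmxDr mulmxDl.
- by move=> c U; rewrite /Phi map_mxZ -scalemxAr -scalemxAl.
have PE : P *m A1 = A2 *m map_mx (frob k) P by rewrite -{1}PhiP mulmxKV.
exists P => //; rewrite unitmxE unitfE; apply/eqP=> /det0_ker[v nzv Pv0].
case/eqP: nzv; apply: anA1; apply: (wedge_ker nzP) => //.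
by rewrite /twist mulmxA PE -mulmxA -map_mxM Pv0 map_mx0 mulmx0.
Qed.

End Frobenius.

(** * The family of quadratic maps *)

Section Family.

Variables (K : fieldExtType 'F_2) (k : nat).

Definition pair_col (p : K * K) : 'cV[K]_2 :=
  \col_i (if i == 0 then p.1 else p.2).

Definition famF_mx (a : K) : 'M[K]_2 :=
  \matrix_(i, j) (if i == 0 then if j == 0 then 0 else a else 1).

Lemma famF_wedge (a : K) p : let T := @twist _ (@frob K k) 1 (famF_mx a) in
  let v := pair_col p in
  famF (frob k) a p = (wedge v (T v), wedge v (T (T v))).
Proof.
case: p => x y /=; rewrite /wedge /twist.
rewrite !GRing.subr_pchar2 ?pchar2 // !(mulmx2E, mxE) /=.
rewrite !(rmorphD, rmorphM, rmorph0, rmorph1).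
by rewrite -!/(frob k _); congr (_, _); ring.
Qed.

Definition pair_mul (P : 'M[K]_2) (p : K * K) : K * K :=
  let v := P *m pair_col p in (v 0 0, v 1 0).

Lemma pair_colK : cancel pair_col (fun v => (v 0 0, v 1 0)).
Proof. by case=> x y; rewrite !mxE. Qed.

Lemma pair_col_mul P p : pair_col (pair_mul P p) = P *m pair_col p.
Proof. by apply/matrixP=> i j; rewrite [j]ord1 mxE; move: i; apply: ord2P. Qed.

Lemma pair_mul_linear P : linear (pair_mul P).
Proof.
move=> c [x y] [z t]; rewrite /pair_mul; congr (_, _);
  by rewrite !mulmx2E !mxE /= !mulrDr -!scalerAr scalerDr addrACA.
Qed.

HB.instance Definition _ P := GRing.isLinear.Build 'F_2
  (K * K)%type (K * K)%type _ (pair_mul P) (pair_mul_linear P).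

Lemma pair_mul_bij P : P \in unitmx -> bijective (pair_mul P).
Proof.
move=> uP; exists (pair_mul (invmx P)) => p; apply: (can_inj pair_colK);
  by rewrite !pair_col_mul ?mulKmx ?mulKVmx.
Qed.

Lemma pair_mul_scalar c x y : pair_mul c%:M (x, y) = (c * x, c * y).
Proof. by rewrite /pair_mul mul_scalar_mx !mxE. Qed.

(** With [T1] and [T2] the two operators, [T2 (P v) = P (T1 v)], so both
coordinates of the second map at [P v] are wedges of images under [P], which is
where the factor [\det P] comes from. *)
Lemma famF_linear_equivalent (a1 a2 : K) P : P \in unitmx ->
  P *m famF_mx a1 = famF_mx a2 *m map_mx (frob k) P ->
  linear_equivalent (famF (frob k) a1) (famF (frob k) a2).
Proof.
move=> uP PE; have TP (v : 'cV_2) :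
    twist (frob k) (famF_mx a2) (P *m v) = P *m twist (frob k) (famF_mx a1) v.
  by rewrite /twist map_mxM !mulmxA PE.
exists (pair_mul (\det P)%:M), (pair_mul P); split=> [||p].
- by apply: pair_mul_bij; rewrite unitmxE det_scalar unitrX // -unitmxE.
- exact: pair_mul_bij.
rewrite -[LHS]/(pair_mul _ _) -[in RHS]/(pair_mul P p).
by rewrite !famF_wedge pair_mul_scalar pair_col_mul !TP !wedge_mulmx.
Qed.

(** Where [v 1 0 != 0], the form is the value of the polynomial at
[v 0 0 / v 1 0] up to a nonzero factor. *)
Lemma no_root_anisotropic a :
  has_no_root (projpoly k a) -> anisotropic (frob k) (famF_mx a).
Proof.
move=> no_root v wv0.
have rootN x : frob k x * x + x + a != 0.
  by have := no_root x; rewrite rootE !hornerE addn1 exprSr.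
have fE : frob k (v 0 0) * v 0 0 + v 0 0 * frob k (v 1 0)
          + a * (frob k (v 1 0) * v 1 0) = 0.
  rewrite -[RHS]wv0 /wedge GRing.subr_pchar2 ?pchar2 // /twist.
  by rewrite !(mulmx2E, mxE) /=; ring.
have v1 : v 1 0 = 0.
  apply/eqP; apply: contraT => nzv1; case/eqP: (rootN (v 0 0 / v 1 0)).
  have nzfv1 : frob k (v 1 0) != 0 by rewrite fmorph_eq0.
  rewrite fmorph_div; apply: (mulIf (mulf_neq0 nzfv1 nzv1)).
  by rewrite mul0r -[RHS]fE; field; rewrite nzv1.
move: fE; rewrite v1 rmorph0 !(mulr0, addr0) => /eqP.
rewrite mulf_eq0 fmorph_eq0 orbb => /eqP v0.
by apply/matrixP=> i j; rewrite [j]ord1 mxE; move: i; apply: ord2P.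
Qed.

Lemma famG_famF : famG (@frob K k) =1 famF (frob k) 1.
Proof.
case=> x y; rewrite /famG /famF rmorph1 addrr_pchar2 ?pchar2 //.
by congr (_, _); ring.
Qed.

End Family.

(** A root satisfies [s(x) = 1 + 1 / x], whose third iterate is the identity;
so it is fixed by [s ^ 3], hence is 0 or 1. The computation multiplies out the
denominators: [s(s(x)) (x + 1) = 1] and then [s(s(s(x))) = x]. *)
Lemma no_root_projpoly1 (K : fieldExtType 'F_2) (k m : nat) :
  (0 < k)%N -> coprime (3 * k) m -> \dim {:K} = m ->
  has_no_root (projpoly k (1 : K)).
Proof.
move=> k_gt0 co_3km dimK x; apply/negP; rewrite rootE !hornerE addn1 exprSr.
rewrite -/(frob k x) => /eqP rx.
have fE : frob k x * x = x + 1.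
  by apply/eqP; rewrite -GRing.subr_eq0 GRing.subr_pchar2 ?pchar2 // addrA rx.
have ffE : frob k (frob k x) * (x + 1) = 1.
  rewrite -fE mulrA -rmorphM fE rmorphD rmorph1 mulrDl mul1r fE addrAC.
  by rewrite addrr_pchar2 ?pchar2 // add0r.
have fffE : frob k (frob k (frob k x)) = x.
  have := congr1 (fun z => frob k z * x) ffE.
  rewrite rmorphM rmorphD !rmorph1 mul1r -mulrA mulrDl mul1r fE addrAC.
  by rewrite addrr_pchar2 ?pchar2 // add0r mulr1.
have: frob (3 * k) x = x.
  by rewrite -[RHS]fffE -[RHS]/(iter 3 (frob k) x) iter_frob mulnC.
move/(frob_fixed co_3km dimK); rewrite muln_gt0 k_gt0 => /(_ isT).
by case/orP=> /eqP x01; move/eqP: fE;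
  rewrite x01 ?rmorph0 ?rmorph1 ?mulr0 ?mulr1 ?add0r ?addrr_pchar2 ?pchar2 // ?[0 == _]eq_sym oner_eq0.
Qed.

Theorem theorem2p4 (m k : nat) (m_gt0 : (0 < m)%N) (k_gt0 : (0 < k)%N)
    (co_km : coprime k m) (K : fieldExtType 'F_2) (dimK : \dim {:K} = m) :
  (forall a1 a2 : K,
     has_no_root (projpoly k a1) -> has_no_root (projpoly k a2) ->
     linear_equivalent (famF (@frob K k) a1) (famF (@frob K k) a2))
  /\
  (~~ (3 %| m)%N ->
   forall a : K, has_no_root (projpoly k a) ->
     exists2 l : nat, coprime (3 * l) m
       & linear_equivalent (famF (@frob K k) a) (famG (@frob K l))).
Proof.
have equivF (a1 a2 : K) : has_no_root (projpoly k a1) ->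
    has_no_root (projpoly k a2) ->
    linear_equivalent (famF (@frob K k) a1) (famF (@frob K k) a2).
  move=> /no_root_anisotropic an1 /no_root_anisotropic an2.
  have [P uP PE] := anisotropic_twisted_conjugate m_gt0 co_km dimK k_gt0 an1 an2.
  exact: famF_linear_equivalent uP PE.
split=> // not3m a no_root; have co_3km : coprime (3 * k) m.
  by rewrite coprimeMl co_km prime_coprime // not3m.
exists k => //.
have no_root1 := no_root_projpoly1 k_gt0 co_3km dimK.
have [L [M [bijL bijM LM]]] := equivF a 1 no_root no_root1.
by exists L, M; split=> // p; rewrite LM famG_famF.
Qed.
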